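(* Let $(Q,c)\in\mathcal{S}^n\times\mathbb{R}^n$. Then $(Q,c)\in\mathcal{E}_R$, i.e., $\ell^*_R=\ell^*$, if and only if there exist a vertex $v$ of $F$ and $(\hat u,\hat v,\hat W,\hat Y,\hat Z)\in\mathbb{R}^n\times\mathbb{R}^n\times\mathcal{S}^n\times\mathbb{R}^{n\times n}\times\mathcal{S}^n$ such that, with $(\hat x,\hat X) = (v,vv^T)$, $$Q = \hat W-\hat Y-\hat Y^T+\hat Z,\qquad c = -\hat u+\hat v-\hat We+\hat Y^Te,$$ $$\hat u^T(e-\hat x)=0,\quad \hat v^T\hat x=0,\quad \langle\hat W,\hat X-\hat xe^T-e\hat x^T+ee^T\rangle=0,\quad \langle\hat Y,e\hat x^T-\hat X\rangle=0,\quad \langle\hat Z,\hat X\rangle=0,$$ $$\hat u\ge0,\quad \hat v\ge0,\quad \hat W\ge0,\quad \hat Y\ge0,\quad \hat Z\ge0.$$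
   Context: Let $n \ge 1$, let $\mathcal{S}^n$ be the space of real symmetric $n\times n$ matrices, $e \in \mathbb{R}^n$ the all-ones vector, $\langle A,B\rangle = \mathrm{trace}(A^TB)$; inequalities on vectors and matrices are componentwise. For $(Q,c) \in \mathcal{S}^n\times\mathbb{R}^n$ let $q(x) = \frac12 x^TQx + c^Tx$, $F = \{x \in \mathbb{R}^n : 0 \le x \le e\}$ (its vertices are the points of $\{0,1\}^n$), and $\ell^* = \min_{x\in F} q(x)$ (the problem (BoxQP)). Let $$\mathcal{F}_R = \{(x,X)\in\mathbb{R}^n\times\mathcal{S}^n : 0\le x\le e,\ \max\{x_i+x_j-1,0\}\le X_{ij}\le \min\{x_i,x_j\},\ 1\le i\le j\le n\},$$ and $\ell^*_R = \min\{\frac12\langle Q,X\rangle + c^Tx : (x,X)\in\mathcal{F}_R\}$ (the RLT relaxation). $\mathcal{E}_R$ denotes the set of $(Q,c)\in\mathcal{S}^n\times\mathbb{R}^n$ with $\ell^*=\ell^*_R$ (exact RLT relaxation). *)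

(* Defs.v *)
From HB Require Import structures.
From mathcomp Require Import all_boot all_order all_algebra.
From mathcomp Require Import all_classical all_reals all_analysis.
From mathcomp Require Import ring lra.
Set Implicit Arguments.
Unset Strict Implicit.
Unset Printing Implicit Defensive.
Import Order.TTheory GRing.Theory Num.Theory.
Import numFieldNormedType.Exports.
Local Open Scope classical_set_scope.
Local Open Scope ring_scope.

(* Vectors of R^n are columns 'cV[R]_n, so vector inequalities are a special
   case of the matrix ones. *)
Definition lemx (R : realType) (m n : nat) (A B : 'M[R]_(m, n)) : Prop :=
  forall i j, A i j <= B i j.
Notation "A <=m B" := (lemx A B) (at level 70, no associativity).

Definition innermx (R : realType) (m n : nat) (A B : 'M[R]_(m, n)) : R :=
  \tr (A^T *m B).

Definition ones (R : realType) (n : nat) : 'cV[R]_n := const_mx 1.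
Arguments ones {R n}.

(* Extreme point; for the unit box these are the 0/1 vectors (vertex_boxP). *)
Definition vertex (R : realType) (V : lmodType R) (A : set V) (x : V) : Prop :=
  A x /\ forall (y z : V) (t : R), A y -> A z -> 0 < t < 1 ->
    x = t *: y + (1 - t) *: z -> y = z.

Definition quad (R : realType) (n : nat) (Q : 'M[R]_n) (c x : 'cV[R]_n) : R :=
  2^-1 * (x^T *m Q *m x) 0 0 + (c^T *m x) 0 0.

Definition boxF (R : realType) (n : nat) : set 'cV[R]_n :=
  [set x | 0 <=m x /\ x <=m ones].
Arguments boxF {R n}.

Definition rltF (R : realType) (n : nat) : set ('cV[R]_n * 'M[R]_n) :=
  [set xX | let: (x, X) := xX in
    [/\ X \is symmetricmx, 0 <=m x, x <=m ones &
      forall i j : 'I_n, (i <= j)%N ->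
        Num.max (x i 0 + x j 0 - 1) 0 <= X i j <= Num.min (x i 0) (x j 0)]].
Arguments rltF {R n}.

Definition rlt_obj (R : realType) (n : nat) (Q : 'M[R]_n) (c : 'cV[R]_n)
    (xX : 'cV[R]_n * 'M[R]_n) : R :=
  2^-1 * innermx Q xX.2 + (c^T *m xX.1) 0 0.

(* Both infima are attained minima: see lstar_min and lstarR_min below. *)
Definition lstar (R : realType) (n : nat) (Q : 'M[R]_n) (c : 'cV[R]_n) : R :=
  inf [set quad Q c x | x in boxF].

Definition lstarR (R : realType) (n : nat) (Q : 'M[R]_n) (c : 'cV[R]_n) : R :=
  inf [set rlt_obj Q c xX | xX in rltF].

Definition exactR (R : realType) (n : nat) : set ('M[R]_n * 'cV[R]_n) :=
  [set Qc | Qc.1 \is symmetricmx /\ lstar Qc.1 Qc.2 = lstarR Qc.1 Qc.2].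
Arguments exactR {R n}.

Lemma symmetricmxP (R : realType) (n : nat) (A : 'M[R]_n) :
  reflect (A^T = A) (A \is symmetricmx).
Proof.
apply: (iffP (is_hermitianmxP _ _ _)); rewrite /= expr0 scale1r map_mx_id //.
Qed.

Lemma vertex_boxP (R : realType) (n : nat) (v : 'cV[R]_n) :
  vertex boxF v <-> forall i, v i 0 = 0 \/ v i 0 = 1.
Proof.
split=> [[[v0 v1] ext] i | v01].
  have := v0 i 0; have := v1 i 0; rewrite !mxE => vi1 vi0.
  have [->|vin0] := eqVneq (v i 0) 0; first by left.
  have [->|vin1] := eqVneq (v i 0) 1; first by right.
  pose y := \col_k (if k == i then 0 else v k 0) : 'cV[R]_n.
  pose z := \col_k (if k == i then 1 else v k 0) : 'cV[R]_n.
  have yF : boxF y.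
    split=> k j; rewrite !mxE; case: eqP => // _.
      by have := v0 k 0; rewrite !mxE.
    by have := v1 k 0; rewrite !mxE.
  have zF : boxF z.
    split=> k j; rewrite !mxE; case: eqP => // _.
      by have := v0 k 0; rewrite !mxE.
    by have := v1 k 0; rewrite !mxE.
  have : y = z.
    apply: (ext _ _ (1 - v i 0) yF zF).
      rewrite subr_gt0 ltrBlDr ltrDl !lt_neqAle vi0 vi1 vin1 /= eq_sym vin0 //.
    apply/colP => k; rewrite !mxE; case: eqP => [->|_]; ring.
  move/colP/(_ i); rewrite !mxE eqxx => /eqP.
  by rewrite eq_sym oner_eq0.
split.
  by split=> i j; rewrite (ord1 j) !mxE; case: (v01 i) => ->.
move=> y z t [y0 y1] [z0 z1] /andP[t0 t1] vE.
apply/colP => i.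
have := y0 i 0; have := y1 i 0; have := z0 i 0; have := z1 i 0.
have := congr1 (fun w : 'cV[R]_n => w i 0) vE; rewrite !mxE.
by case: (v01 i) => -> E *; nra.
Qed.

Lemma rltF_vertex (R : realType) (n : nat) (x : 'cV[R]_n) :
  boxF x -> rltF (x, x *m x^T).
Proof.
move=> [x0 x1]; split=> //; first by apply/symmetricmxP; rewrite trmx_mul trmxK.
move=> i j _; rewrite mxE big_ord1 !mxE ge_max le_min.
have := x0 i 0; have := x1 i 0; have := x0 j 0; have := x1 j 0; rewrite !mxE.
by move=> *; apply/andP; split; apply/andP; split; nra.
Qed.

Lemma inf_min (R : realType) (T : Type) (f : T -> R) (A : set T) (a : T) :
  A a -> (forall b, A b -> f a <= f b) -> inf (f @` A) = f a.
Proof.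
move=> Aa fa; apply/eqP; rewrite eq_le; apply/andP; split.
  by apply: ge_inf; [exists (f a) => _ [b /fa ? <-] | exists a].
by apply: lb_le_inf; [exists (f a), a | move=> _ [b /fa ? <-]].
Qed.

Lemma compact_unit_box (R : realType) (m : nat) :
  compact [set v : 'rV[R]_m | forall i, `[0, 1]%classic (v ord0 i)].
Proof.
have := (@rV_compact R m (fun=> `[0, 1]%classic) (fun=> @segment_compact _ 0 1)).
exact.
Qed.

Lemma quadE (R : realType) (n : nat) (Q : 'M[R]_n) (c x : 'cV[R]_n) :
  quad Q c x = 2^-1 * (\sum_j (\sum_i x i 0 * Q i j) * x j 0)
    + \sum_i c i 0 * x i 0.
Proof.
rewrite /quad !mxE; congr (_ * _ + _).
  apply: eq_bigr => j _; rewrite mxE; congr (_ * _).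
  by apply: eq_bigr => i _; rewrite mxE.
by apply: eq_bigr => j _; rewrite mxE.
Qed.

Lemma innermxE (R : realType) (m n : nat) (A B : 'M[R]_(m, n)) :
  innermx A B = \sum_j \sum_i A i j * B i j.
Proof.
rewrite /innermx /mxtrace; apply: eq_bigr => j _; rewrite mxE.
by apply: eq_bigr => i _; rewrite mxE.
Qed.

Lemma continuous_sum_ord (R : realType) (T : topologicalType) (n : nat)
    (f : 'I_n -> T -> R) :
  (forall i, continuous (f i)) -> continuous (fun x => \sum_i f i x).
Proof.
move=> cf; apply: continuous_big => [|i _]; last exact: cf.
by move=> z; apply: cvgD; [exact: cvg_fst | exact: cvg_snd].
Qed.

Lemma continuous_mul (R : realType) (T : topologicalType) (f g : T -> R) :
  continuous f -> continuous g -> continuous (fun x => f x * g x).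
Proof. by move=> cf cg x; apply: cvgM; [exact: cf | exact: cg]. Qed.

Lemma continuous_add (R : realType) (T : topologicalType) (f g : T -> R) :
  continuous f -> continuous g -> continuous (fun x => f x + g x).
Proof. by move=> cf cg x; apply: cvgD; [exact: cf | exact: cg]. Qed.

Lemma continuous_opp (R : realType) (T : topologicalType) (f : T -> R) :
  continuous f -> continuous (fun x => - f x).
Proof. by move=> cf x; apply: cvgN; exact: cf. Qed.

Lemma continuous_const (R : realType) (T : topologicalType) (k : R) :
  continuous (fun _ : T => k).
Proof. by move=> x; exact: cvg_cst. Qed.

Lemma lstar_min (R : realType) (n : nat) (Q : 'M[R]_n) (c : 'cV[R]_n) :
  exists x, [/\ boxF x, quad Q c x = lstar Q c &
    forall y, boxF y -> lstar Q c <= quad Q c y].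
Proof.
pose A := [set v : 'rV[R]_n | forall i, `[0, 1]%classic (v ord0 i)].
have AF v : A v <-> boxF v^T.
  split=> [Av | [v0 v1] i].
    by split=> i j; have := Av i; rewrite /= in_itv /= (ord1 j) !mxE => /andP[].
  have := v0 i 0; have := v1 i 0; rewrite !mxE => v1' v0'.
  by rewrite /= in_itv /= v0' v1'.
have A0 : A !=set0.
  by exists 0 => i; rewrite /= in_itv /= mxE lexx ler01.
have cf : continuous (fun v : 'rV[R]_n => quad Q c v^T).
  have cc i : continuous (fun v : 'rV[R]_n => v^T i 0).
    rewrite (_ : (fun _ => _) = (fun v : 'rV[R]_n => v 0 i)).
      exact: coord_continuous.
    by apply/funext => v; rewrite mxE.
  rewrite (_ : (fun _ => _) = (fun v : 'rV[R]_n =>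
      2^-1 * (\sum_j (\sum_i v^T i 0 * Q i j) * v^T j 0)
      + \sum_i c i 0 * v^T i 0)); last by apply/funext => v; rewrite quadE.
  apply: continuous_add.
    apply: continuous_mul; first exact: continuous_const.
    apply: continuous_sum_ord => j; apply: continuous_mul; last exact: cc.
    apply: continuous_sum_ord => i; apply: continuous_mul; first exact: cc.
    exact: continuous_const.
  apply: continuous_sum_ord => i; apply: continuous_mul; last exact: cc.
  exact: continuous_const.
have [w wA wmin] := compact_EVT_min A0 (@compact_unit_box R n)
  (continuous_subspaceT cf).
have wF : boxF w^T by apply/AF; rewrite inE in wA.
have wm y : boxF y -> quad Q c w^T <= quad Q c y.
  move=> yF; rewrite -[y]trmxK; apply: (wmin y^T).
  by rewrite inE; apply/AF; rewrite trmxK.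
by exists w^T; split=> // [|y yF]; rewrite /lstar (inf_min wF wm) //; exact: wm.
Qed.

Lemma lstarR_min (R : realType) (n : nat) (Q : 'M[R]_n) (c : 'cV[R]_n) :
  exists xX, [/\ rltF xX, rlt_obj Q c xX = lstarR Q c &
    forall yY, rltF yY -> lstarR Q c <= rlt_obj Q c yY].
Proof.
pose g (w : 'rV[R]_(n + n * n)) : 'cV[R]_n * 'M[R]_n :=
  ((lsubmx w)^T, vec_mx (rsubmx w)).
pose A := [set w | rltF (g w)].
have gK xX : exists w, g w = xX.
  exists (row_mx xX.1^T (mxvec xX.2)).
  by rewrite /g row_mxKl row_mxKr trmxK mxvecK; case: xX.
have c1 i : continuous (fun w => (g w).1 i 0).
  rewrite (_ : (fun _ => _) = (fun w : 'rV[R]_(n + n * n) => w 0 (lshift _ i))).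
    exact: coord_continuous.
  by apply/funext => v; rewrite !mxE.
have c2 i j : continuous (fun w => (g w).2 i j).
  rewrite (_ : (fun _ => _) =
      (fun w : 'rV[R]_(n + n * n) => w 0 (rshift _ (mxvec_index i j)))).
    exact: coord_continuous.
  by apply/funext => v; rewrite !mxE.
have cle (f h : 'rV[R]_(n + n * n) -> R) : continuous f -> continuous h ->
    closed [set w | f w <= h w].
  move=> cf ch; rewrite (_ : [set _ | _] = (fun w => h w - f w) @^-1` [set x | 0 <= x]).
    apply: (@preimage_closed _ R); last exact: closed_ge.
    move=> w _; move: w; apply: continuous_add => //.
    by apply: continuous_opp.
  by apply/seteqP; split=> w /=; rewrite subr_ge0.
pose S (i j : 'I_n) := [set w | [/\ (g w).2 i j <= (g w).2 j i,
  0 <= (g w).1 i 0, (g w).1 i 0 <= 1 &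
  ((i <= j)%N -> [/\ (g w).1 i 0 + (g w).1 j 0 - 1 <= (g w).2 i j,
    0 <= (g w).2 i j, (g w).2 i j <= (g w).1 i 0 & (g w).2 i j <= (g w).1 j 0])]].
have AE : A = \bigcap_(p in [set: 'I_n * 'I_n]) S p.1 p.2.
  apply/seteqP; split=> w.
    rewrite /A /= => -[/symmetricmxP sX x0 x1 b] [i j] _ /=; split.
    - by have /= := congr1 (fun M : 'M[R]_n => M i j) sX; rewrite [_^T _ _]mxE => ->.
    - by have := x0 i 0; rewrite mxE.
    - by have := x1 i 0; rewrite [ones _ _]mxE.
    - by move=> /b; rewrite ge_max le_min => /andP[/andP[? ?] /andP[? ?]].
  move=> Sw; split.
  - apply/symmetricmxP/matrixP => i j; rewrite mxE.
    case: (Sw (i, j) I) => /= + _ _ _; case: (Sw (j, i) I) => /= + _ _ _ => ? ?.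
    by apply/eqP; rewrite eq_le; apply/andP.
  - by move=> i j; rewrite (ord1 j) mxE; case: (Sw (i, i) I).
  - by move=> i j; rewrite (ord1 j) [ones _ _]mxE; case: (Sw (i, i) I).
  - move=> i j ij; case: (Sw (i, j) I) => /= _ _ _ /(_ ij)[? ? ? ?].
    by rewrite ge_max le_min; apply/andP; split; apply/andP.
have clA : closed A.
  rewrite AE; apply: closed_bigI => -[i j] _ /=.
  have cst (k : R) : continuous (fun _ : 'rV[R]_(n + n * n) => k).
    exact: continuous_const.
  have SE : S i j = [set w | (g w).2 i j <= (g w).2 j i]
      `&` [set w | 0 <= (g w).1 i 0] `&` [set w | (g w).1 i 0 <= 1]
      `&` [set w | (i <= j)%N ->
           [/\ (g w).1 i 0 + (g w).1 j 0 - 1 <= (g w).2 i j,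
    0 <= (g w).2 i j, (g w).2 i j <= (g w).1 i 0 & (g w).2 i j <= (g w).1 j 0]].
    by apply/seteqP; split=> w /=; [case=> ? ? ? ? | case=> [[[? ?] ?] ?]].
  rewrite SE; apply: closedI; first by do !apply: closedI; apply: cle.
  have [ij|ij] := boolP (i <= j)%N; last first.
    rewrite (_ : [set _ | _] = setT); first exact: closedT.
    by apply/seteqP; split.
  rewrite (_ : [set _ | _] =
     [set w | (g w).1 i 0 + (g w).1 j 0 - 1 <= (g w).2 i j]
     `&` [set w | 0 <= (g w).2 i j] `&` [set w | (g w).2 i j <= (g w).1 i 0]
     `&` [set w | (g w).2 i j <= (g w).1 j 0]).
    do !apply: closedI; apply: cle => //.
    apply: continuous_add; last exact: continuous_const.
    by apply: continuous_add; exact: c1.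
  by apply/seteqP; split=> w /=; [case=> // ? ? ? ? | case=> [[[? ?] ?] ?] _].
have cA : compact A.
  apply: subclosed_compact clA (@compact_unit_box R _) _ => w Aw k.
  have := Aw; rewrite AE => Sw.
  rewrite -[w]hsubmxK mxE; case: fintype.split => [i|k'].
    by case: (Sw (i, i) I) => /= _ + + _; rewrite in_itv /= !mxE => -> ->.
  case/mxvec_indexP: k' => i j.
  wlog ij : i j / (i <= j)%N => [H|].
    have [/H //|ji] := leqP i j.
    case: Aw => /symmetricmxP /matrixP /(_ j i) + _ _ _.
    by have := H _ _ (ltnW ji); rewrite /= !mxE => + E; rewrite E.
  case: (Sw (i, j) I) => /= _ _ x1 /(_ ij) [_ X0 X1 _]; move: x1 X0 X1.
  rewrite in_itv /= !mxE => x1 -> X1 /=; exact: le_trans X1 x1.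
have A0 : A !=set0.
  have [w wE] := gK (0, (0 : 'cV[R]_n) *m 0^T); exists w; change (rltF (g w)); rewrite wE.
  by apply: rltF_vertex; split=> i j; rewrite !mxE ?lexx ?ler01.
have cf : continuous (fun w => rlt_obj Q c (g w)).
  rewrite (_ : (fun _ => _) = (fun w =>
      2^-1 * (\sum_j \sum_i Q i j * (g w).2 i j)
      + \sum_i c i 0 * (g w).1 i 0)); last first.
    apply/funext => w; rewrite /rlt_obj innermxE mxE; congr (_ + _).
    by apply: eq_bigr => i _; rewrite [c^T _ _]mxE.
  apply: continuous_add.
    apply: continuous_mul; first exact: continuous_const.
    apply: continuous_sum_ord => j; apply: continuous_sum_ord => i.
    by apply: continuous_mul; [exact: continuous_const | exact: c2].
  apply: continuous_sum_ord => i; apply: continuous_mul; last exact: c1.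
  exact: continuous_const.
have [w wA wmin] := compact_EVT_min A0 cA (continuous_subspaceT cf).
have wF : rltF (g w) by rewrite inE in wA.
have wm y : rltF y -> rlt_obj Q c (g w) <= rlt_obj Q c y.
  by have [u <-] := gK y => uF; apply: wmin; rewrite inE.
by exists (g w); split=> // [|y yF]; rewrite /lstarR (inf_min wF wm) //; exact: wm.
Qed.

(* Main.v *)
Require Import Defs.
From mathcomp Require Import all_boot all_order all_algebra.
From mathcomp Require Import all_classical all_reals all_analysis.
From mathcomp Require Import ring lra.
Set Implicit Arguments.
Unset Strict Implicit.
Unset Printing Implicit Defensive.
Import Order.TTheory GRing.Theory Num.Theory.
Local Open Scope classical_set_scope.
Local Open Scope ring_scope.

(** The relaxation is a linear program, and the displayed system says that
    [(v, v v^T)] is primal feasible and that the multipliers are dual feasible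
    and complementary to it.

    If the system has a solution, the Lagrangian identity [rlt_objE] writes the
    objective at a feasible [(x, X)] as a constant plus a nonnegative pairing of
    multipliers with constraint slacks, and this pairing vanishes at
    [(v, v v^T)].  Hence [(v, v v^T)] minimises the relaxation; its objective
    there is [q(v)], and since every [(x, x x^T)] with [x] in the box is
    feasible, [v] also minimises [q] and the two values agree
    ([exactR_of_rank1]).

    Conversely, let the relaxation be exact and let [x] minimise [q] over the
    box.  Then [(x, x x^T)] is optimal for the relaxation.  Linear programming
    duality ([rlt_dual], derived from the Farkas lemma [farkas]) provides
    multipliers whose pairing with the slacks at [(x, x x^T)] is zero.  The
    point [x] need not be a vertex, but at a rank-one point each slack is a
    single factor or a product of two factors among the [x_i] and [1 - x_i]:
    [1 - x_i], [x_i], [(1 - x_i) (1 - x_j)], [x_j (1 - x_i)], [x_i x_j].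
    Rounding every fractional coordinate down to [0] keeps each vanishing factor
    equal to zero, so the same multipliers are complementary to the rounded
    point, which is a vertex ([rlt_pairing_round]). *)

(** * The Farkas lemma over an ordered field *)

(** Induction on the number of functionals.  If [g] is already nonnegative where
    all but the first functional are, the first one gets multiplier zero.
    Otherwise some [y] violates this; projecting along [y] onto the kernel of
    the first functional removes that functional, and the value of its
    multiplier is forced by evaluation at [y]. *)
Lemma farkas_ord (R : realFieldType) (V : lmodType R) (m : nat)
    (a : 'I_m -> V -> R) (g : V -> R) :
  (forall i, scalar (a i)) -> scalar g ->
  (forall x, (forall i, 0 <= a i x) -> 0 <= g x) ->
  exists2 l : 'I_m -> R, forall i, 0 <= l i &
    forall x, g x = \sum_i l i * a i x.
Proof.
elim: m a g => [|m IHm] a g a_lin g_lin gP.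
  exists (fun=> 0) => // x; rewrite big_ord0; apply/eqP.
  have gN : g (- x) = - g x.
    have g0 : g 0 = 0 by have := g_lin 1 0 0; rewrite scaler0 addr0 /=; lra.
    by have := g_lin (-1) x 0; rewrite scaleN1r addr0 g0 => ->; ring.
  have x0 : 0 <= g x by apply: gP => -[].
  have : 0 <= g (- x) by apply: gP => -[].
  by rewrite gN oppr_ge0 eq_le x0 andbT.
pose b i := a (lift ord0 i).
have [[y [by_ge0 gy]]|noy] := pselect (exists y, (forall i, 0 <= b i y) /\ g y < 0);
  last first.
  have [|l l0 lE] := IHm b g (fun i => a_lin _) g_lin.
    by move=> x bx; rewrite leNgt; apply/negP => gx; apply: noy; exists x.
  exists (fun i => oapp l 0 (unlift ord0 i)) => [i|x].
    by case: unliftP => //= j _.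
  rewrite big_ord_recl unlift_none /= mul0r add0r lE.
  by apply: eq_bigr => i _; rewrite liftK.
have ay : a ord0 y < 0.
  rewrite ltNge; apply/negP => ay; move: gy; rewrite ltNge gP // => i.
  by case: (unliftP ord0 i) => [j|] -> //; exact: by_ge0.
(* The projection along y onto the kernel of the first functional. *)
pose p x := x - (a ord0 x / a ord0 y) *: y.
have pE f : scalar f -> forall x, f (p x) = f x - a ord0 x / a ord0 y * f y.
  move=> f_lin x; have := f_lin (- (a ord0 x / a ord0 y)) y x.
  by rewrite scaleNr [_ + x]addrC /p => ->; rewrite /=; ring.
have p_lin f : scalar f -> scalar (f \o p).
  by move=> f_lin k u v; rewrite /= !pE // f_lin a_lin /=; ring.
have [|l l0 lE] := IHm (fun i => b i \o p) (g \o p)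
    (fun i => p_lin _ (a_lin _)) (p_lin _ g_lin).
  move=> x bx; apply: gP => i; case: (unliftP ord0 i) => [j|] -> //.
    exact: bx.
  by rewrite pE // mulfVK ?subrr // lt_eqF.
(* Chosen so that the representation of g is correct at y. *)
pose l_0 := (g y - \sum_i l i * b i y) / a ord0 y.
exists (fun i => oapp l l_0 (unlift ord0 i)) => [i|x].
  case: unliftP => [j|] _ //=; apply: mulr_le0; last by rewrite invr_le0 ltW.
  rewrite subr_le0; apply: le_trans (ltW gy) _.
  by apply: sumr_ge0 => i0 _; rewrite mulr_ge0.
have := lE x; rewrite /= pE // => /eqP; rewrite subr_eq => /eqP ->.
have -> : \sum_i l i * b i (p x) =
    \sum_i l i * b i x - a ord0 x / a ord0 y * \sum_i l i * b i y.
  rewrite mulr_sumr -sumrB; apply: eq_bigr => i _; rewrite pE; first by ring.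
  exact: a_lin.
rewrite big_ord_recl unlift_none /=.
under [in RHS]eq_bigr => i _ do rewrite liftK /=.
rewrite -/b /l_0; field.
by rewrite lt_eqF.
Qed.

Lemma farkas (R : realFieldType) (V : lmodType R) (I : finType)
    (a : I -> V -> R) (g : V -> R) :
  (forall i, scalar (a i)) -> scalar g ->
  (forall x, (forall i, 0 <= a i x) -> 0 <= g x) ->
  exists2 l : I -> R, forall i, 0 <= l i & forall x, g x = \sum_i l i * a i x.
Proof.
move=> a_lin g_lin gP.
have [|l l0 lE] := @farkas_ord R V #|I| (a \o enum_val) g (fun i => a_lin _) g_lin.
  by move=> x ax; apply: gP => i; have := ax (enum_rank i); rewrite /= enum_rankK.
exists (l \o enum_rank) => [i|x]; first exact: l0.
rewrite lE (reindex _ (onW_bij _ (@enum_val_bij I))) /=.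
by apply: eq_bigr => i _; rewrite enum_valK.
Qed.

(** * The trace inner product *)

Section Inner.
Variables (R : realType) (m n : nat).
Implicit Types A B C : 'M[R]_(m, n).

Lemma innermxDr A B C : innermx A (B + C) = innermx A B + innermx A C.
Proof. by rewrite /innermx mulmxDr mxtraceD. Qed.

Lemma innermxNr A B : innermx A (- B) = - innermx A B.
Proof. by rewrite /innermx mulmxN raddfN. Qed.

Lemma innermxZr k A B : innermx A (k *: B) = k * innermx A B.
Proof. by rewrite /innermx -scalemxAr mxtraceZ. Qed.

Lemma innermx0r A : innermx A 0 = 0.
Proof. by rewrite -(scale0r 0) innermxZr mul0r. Qed.

Lemma innermxC A B : innermx A B = innermx B A.
Proof. by rewrite /innermx -mxtrace_tr trmx_mul trmxK. Qed.

Lemma innermxDl A B C : innermx (A + B) C = innermx A C + innermx B C.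
Proof. by rewrite !(innermxC _ C) innermxDr. Qed.

Lemma innermxNl A B : innermx (- A) B = - innermx A B.
Proof. by rewrite !(innermxC _ B) innermxNr. Qed.

Lemma innermxZl k A B : innermx (k *: A) B = k * innermx A B.
Proof. by rewrite !(innermxC _ B) innermxZr. Qed.

Lemma innermx_tr A B : innermx A^T B^T = innermx A B.
Proof. by rewrite innermxC /innermx trmxK mxtrace_mulC. Qed.

Lemma innermx_outer A (x : 'cV[R]_m) (y : 'cV[R]_n) :
  innermx A (x *m y^T) = innermx (A *m y) x.
Proof. by rewrite /innermx mulmxA mxtrace_mulC trmx_mul mulmxA. Qed.

Lemma innermx_pair A B :
  innermx A B = \sum_(p : 'I_m * 'I_n) A p.1 p.2 * B p.1 p.2.
Proof. by rewrite innermxE exchange_big pair_bigA. Qed.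

Lemma innermx_ge0 A B : 0 <=m A -> 0 <=m B -> 0 <= innermx A B.
Proof.
move=> A0 B0; rewrite innermx_pair sumr_ge0 // => p _.
by have := A0 p.1 p.2; have := B0 p.1 p.2; rewrite !mxE => ? ?; rewrite mulr_ge0.
Qed.

Lemma innermx_inj A B : (forall C, innermx A C = innermx B C) -> A = B.
Proof.
move=> AB; apply/matrixP => i j.
have D (M : 'M[R]_(m, n)) : innermx M (delta_mx i j) = M i j.
  rewrite innermx_pair (bigD1 (i, j)) //= mxE !eqxx mulr1 big1 ?addr0 //.
  move=> [k l]; rewrite xpair_eqE mxE /= => /negPf ->; exact: mulr0.
by rewrite -!D AB.
Qed.

(** Complementary slackness depends only on where the slack [B] vanishes: the
    multiplier [A] stays complementary to any [C] supported inside [B]. *)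
Lemma innermx_eq0_supp A B C : 0 <=m A -> 0 <=m B ->
  (forall i j, B i j = 0 -> C i j = 0) -> innermx A B = 0 -> innermx A C = 0.
Proof.
move=> A0 B0 BC; rewrite !innermx_pair => /eqP; rewrite psumr_eq0; last first.
  move=> p _; have := A0 p.1 p.2; have := B0 p.1 p.2; rewrite !mxE => ? ?.
  by rewrite mulr_ge0.
move=> /allP AB0; apply: big1 => p _.
have /eqP/eqP := AB0 p (mem_index_enum _); rewrite mulf_eq0.
by case/orP => /eqP E; [rewrite E mul0r | rewrite (BC _ _ E) mulr0].
Qed.

End Inner.

Section Symmetrization.
Variables (R : realType) (n : nat).
Implicit Types A B : 'M[R]_n.

Lemma symmetricmx_addtr A : A + A^T \is symmetricmx.
Proof. by apply/symmetricmxP; rewrite linearD /= trmxK addrC. Qed.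

Lemma addtr_ge0 A : 0 <=m A -> 0 <=m (A + A^T).
Proof.
by move=> A0 i j; have := A0 i j; have := A0 j i; rewrite !mxE; lra.
Qed.

Lemma innermx_addtr A B :
  B \is symmetricmx -> innermx (A + A^T) B = 2 * innermx A B.
Proof.
move=> /symmetricmxP sB; rewrite innermxDl -[innermx A^T B]innermx_tr trmxK sB.
ring.
Qed.

Lemma half_addtr A : A \is symmetricmx -> 2^-1 *: A + (2^-1 *: A)^T = A.
Proof.
move=> /symmetricmxP sA; rewrite linearZ /= sA -scalerDl -[RHS]scale1r.
by congr (_ *: _); field.
Qed.

Lemma outer_symmetric (x : 'cV[R]_n) : x *m x^T \is symmetricmx.
Proof. by apply/symmetricmxP; rewrite trmx_mul trmxK. Qed.

End Symmetrization.

Lemma innermx_cV (R : realType) (n : nat) (x y : 'cV[R]_n) :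
  x^T *m y = (innermx x y)%:M.
Proof. by rewrite /innermx trace_mx11 -mx11_scalar. Qed.

(** * Slacks and the Lagrangian of the homogenised relaxation *)

Section Lagrangian.
Variables (R : realType) (n : nat).
Implicit Types (t : R) (x u v : 'cV[R]_n) (X D W Y Z Q : 'M[R]_n).

(** The scalar [t] homogenises the constraints: the relaxation itself is the
    slice [t = 1], while all [t] together form a polyhedral cone.  The
    nonnegativity constraints on [x] and [X] are their own slacks. *)
Definition slackU t x := t *: ones - x.
Definition slackW t x X := X - x *m ones^T - ones *m x^T + t *: (ones *m ones^T).
Definition slackY x X := ones *m x^T - X.

Lemma slackUE t x i j : slackU t x i j = t - x i 0.
Proof. by rewrite !mxE ord1; ring. Qed.

Lemma slackWE t x X i j : slackW t x X i j = X i j - x i 0 - x j 0 + t.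
Proof. by rewrite !(mxE, big_ord1); ring. Qed.

Lemma slackYE x X i j : slackY x X i j = x j 0 - X i j.
Proof. by rewrite !(mxE, big_ord1); ring. Qed.

Definition rlt_nonneg t x X : Prop :=
  [/\ 0 <=m slackU t x, 0 <=m x, 0 <=m slackW t x X, 0 <=m slackY x X & 0 <=m X].

(** The relaxation only constrains the entries with [i <= j]; by symmetry of [X]
    this amounts to nonnegativity of whole slack matrices. *)
Lemma rltFP x X : rltF (x, X) <-> X \is symmetricmx /\ rlt_nonneg 1 x X.
Proof.
split=> [[sX x0 x1 b] | [sX [U0 V0 W0 Y0 Z0]]].
  split=> //.
  have Xb i j : [/\ x i 0 + x j 0 - 1 <= X i j, 0 <= X i j, X i j <= x i 0 &
      X i j <= x j 0].
    wlog ij : i j / (i <= j)%N => [H|].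
      have [/H //|ji] := leqP i j; have [] := H _ _ (ltnW ji).
      have /symmetricmxP/matrixP/(_ i j) := sX; rewrite mxE => -> *.
      by split=> //; lra.
    by have := b i j ij; rewrite ge_max le_min => /andP[/andP[? ?] /andP[? ?]].
  split=> // i j; rewrite ?slackUE ?slackWE ?slackYE [leLHS]mxE.
  - by have := x1 i 0; rewrite mxE subr_ge0.
  - by have [] := Xb i j; lra.
  - by have [] := Xb i j; lra.
  - by have [] := Xb i j.
split=> // [i j|i j _].
  by have := U0 i j; rewrite slackUE ord1 !mxE subr_ge0.
rewrite ge_max le_min.
have := W0 i j; have := Y0 i j; have := Y0 j i; have := Z0 i j.
have /symmetricmxP/matrixP/(_ i j) := sX; rewrite mxE.
rewrite slackWE !slackYE !mxE => -> *.
by apply/andP; split; apply/andP; split; lra.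
Qed.

Definition rlt_pairing u v W Y Z t x X : R :=
  innermx u (slackU t x) + innermx v x + innermx W (slackW t x X)
  + innermx Y (slackY x X) + innermx Z X.

(** Collecting coefficients in the Lagrangian.  Parametrising the symmetric
    matrices as [D + D^T] with [D] arbitrary makes the coefficient of [D]
    unique and produces the combination [W + W^T - Y - Y^T + (Z + Z^T)]
    in which the multipliers enter the stationarity condition on [Q]. *)
Lemma rlt_pairingE u v W Y Z t x D :
  rlt_pairing u v W Y Z t x (D + D^T) =
    t * (innermx u ones + innermx W (ones *m ones^T))
    + innermx (- u + v - (W + W^T) *m ones + Y^T *m ones) x
    + innermx (W + W^T - Y - Y^T + (Z + Z^T)) D.
Proof.
have symr A : innermx A (D + D^T) = innermx (A + A^T) D.
  by rewrite innermxDr innermxDl -[innermx A^T D]innermx_tr trmxK.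
have outer A : innermx A (ones *m x^T) = innermx (A^T *m ones) x.
  by rewrite -innermx_tr trmx_mul trmxK innermx_outer.
rewrite /rlt_pairing /slackU /slackW /slackY.
rewrite !(innermxDr, innermxNr, innermxZr) -!innermxDr !outer !innermx_outer.
rewrite !symr mulmxDl.
rewrite !(innermxDl, innermxNl); ring.
Qed.

End Lagrangian.

(** Stationarity of the Lagrangian makes the objective differ from the pairing
    by a constant: nonnegativity of the pairing is weak duality, its vanishing
    is optimality. *)
Lemma rlt_objE (R : realType) (n : nat) (Q W Y Z X : 'M[R]_n)
    (c u v x : 'cV[R]_n) :
  Q = W + W^T - Y - Y^T + (Z + Z^T) ->
  c = - u + v - (W + W^T) *m ones + Y^T *m ones -> X \is symmetricmx ->
  rlt_obj Q c (x, X) = rlt_pairing u v W Y Z 1 x X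
    - (innermx u ones + innermx W (ones *m ones^T)).
Proof.
move=> QE cE sX.
rewrite -[X in rlt_pairing _ _ _ _ _ _ _ X]half_addtr // rlt_pairingE -QE -cE mul1r.
rewrite innermxZr /rlt_obj /= innermx_cV mxE eqxx mulr1n; ring.
Qed.

Lemma quad_rlt_obj (R : realType) (n : nat) (Q : 'M[R]_n) (c x : 'cV[R]_n) :
  Q \is symmetricmx -> quad Q c x = rlt_obj Q c (x, x *m x^T).
Proof.
move=> /symmetricmxP sQ; rewrite /quad /rlt_obj /= innermx_outer.
have -> : x^T *m Q = (Q *m x)^T by rewrite trmx_mul sQ.
by rewrite [(Q *m x)^T *m x]innermx_cV [_%:M _ _]mxE eqxx mulr1n.
Qed.

(** * Linear programming duality for the relaxation *)

Section Multipliers.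
Variables (R : realType) (n : nat).

(** One index per scalar constraint of the cone, in the order [U], [V], [W], [Y],
    [Z] of the multipliers. *)
Definition rlt_idx : finType :=
  ('I_n + 'I_n + 'I_n * 'I_n + 'I_n * 'I_n + 'I_n * 'I_n)%type.

Definition rlt_slack (k : rlt_idx) (p : R^o * 'cV[R]_n * 'M[R]_n) : R :=
  let: (t, x, D) := p in
  match k with
  | inl (inl (inl (inl i))) => slackU t x i 0
  | inl (inl (inl (inr i))) => x i 0
  | inl (inl (inr (i, j))) => slackW t x (D + D^T) i j
  | inl (inr (i, j)) => slackY x (D + D^T) i j
  | inr (i, j) => (D + D^T) i j
  end.

Lemma rlt_slack_scalar k : scalar (rlt_slack k).
Proof.
move=> a [[t x] D] [[t' x'] D'].
case: k => [[[[i|i]|[i j]]|[i j]]|[i j]] /=;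
  rewrite ?slackUE ?slackWE ?slackYE !mxE; rewrite /GRing.scale /=; ring.
Qed.

Lemma sum_rlt_slack (l : rlt_idx -> R) t x D :
  \sum_k l k * rlt_slack k (t, x, D) =
  rlt_pairing (\col_i l (inl (inl (inl (inl i)))))
    (\col_i l (inl (inl (inl (inr i)))))
    (\matrix_(i, j) l (inl (inl (inr (i, j)))))
    (\matrix_(i, j) l (inl (inr (i, j)))) (\matrix_(i, j) l (inr (i, j)))
    t x (D + D^T).
Proof.
have col (f : 'I_n -> R) y : innermx (\col_i f i) y = \sum_i f i * y i 0.
  by rewrite innermxE big_ord1; apply: eq_bigr => i _; rewrite mxE.
have mat (f : 'I_n * 'I_n -> R) A :
    innermx (\matrix_(i, j) f (i, j)) A = \sum_p f p * A p.1 p.2.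
  by rewrite innermx_pair; apply: eq_bigr => -[i j] _; rewrite mxE.
rewrite /rlt_pairing !col !(mat (fun p => l _)).
rewrite !big_sumType /=; do ?congr (_ + _) => //;
  by apply: eq_bigr => -[i j] _.
Qed.

Lemma rlt_slack_ge0 t x D :
  (forall k, 0 <= rlt_slack k (t, x, D)) <-> rlt_nonneg t x (D + D^T).
Proof.
split=> [H | [U0 V0 W0 Y0 Z0] [[[[i|i]|[i j]]|[i j]]|[i j]]].
- split=> i j; rewrite [leLHS]mxE.
  + by rewrite ord1; exact: (H (inl (inl (inl (inl i))))).
  + by rewrite ord1; exact: (H (inl (inl (inl (inr i))))).
  + exact: (H (inl (inl (inr (i, j))))).
  + exact: (H (inl (inr (i, j)))).
  + exact: (H (inr (i, j))).
- by have := U0 i 0; rewrite mxE.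
- by have := V0 i 0; rewrite mxE.
- by have := W0 i j; rewrite [leLHS]mxE.
- by have := Y0 i j; rewrite [leLHS]mxE.
- by have := Z0 i j; rewrite [leLHS]mxE.
Qed.

Lemma rlt_nonneg_scale k t x (X : 'M[R]_n) :
  0 <= k -> rlt_nonneg t x X -> rlt_nonneg (k * t) (k *: x) (k *: X).
Proof.
move=> k0 [U0 V0 W0 Y0 Z0]; split=> i j.
- have := U0 i j; rewrite !slackUE !mxE -mulrBr => ?; exact: mulr_ge0.
- have := V0 i j; rewrite !mxE => ?; exact: mulr_ge0.
- have := W0 i j; rewrite !slackWE !mxE -!mulrBr -mulrDr => ?; exact: mulr_ge0.
- have := Y0 i j; rewrite !slackYE !mxE -!mulrBr => ?; exact: mulr_ge0.
- have := Z0 i j; rewrite !mxE => ?; exact: mulr_ge0.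
Qed.

(** Strong duality.  A lower bound [l] on the relaxation means that the linear
    form [<Q, D> + c^T x - l t] is nonnegative on the cone of homogenised
    constraints: for [t > 0] by scaling to [t = 1], and for [t = 0] because the
    feasible set is bounded, so that [x] and [D + D^T] vanish.  The Farkas lemma
    then represents this form as a pairing of multipliers with slacks, and
    comparing coefficients gives the three identities. *)
Lemma rlt_dual (Q : 'M[R]_n) (c : 'cV[R]_n) (l : R) :
  (0 < n)%N -> Q \is symmetricmx ->
  (forall xX, rltF xX -> l <= rlt_obj Q c xX) ->
  exists u v (W Y Z : 'M[R]_n),
    [/\ [/\ 0 <=m u, 0 <=m v, 0 <=m W, 0 <=m Y & 0 <=m Z],
        Q = W + W^T - Y - Y^T + (Z + Z^T),
        c = - u + v - (W + W^T) *m ones + Y^T *m ones &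
        - l = innermx u ones + innermx W (ones *m ones^T)].
Proof.
move=> n0 sQ lP.
pose g (p : R^o * 'cV[R]_n * 'M[R]_n) : R :=
  let: (t, x, D) := p in innermx Q D + innermx c x - l * t.
have QD D : innermx Q (D + D^T) = 2 * innermx Q D.
  by rewrite innermxC innermx_addtr // innermxC.
have g_lin : scalar g.
  move=> a [[t x] D] [[t' x'] D'] /=.
  by rewrite !(innermxDr, innermxZr) /GRing.scale /=; ring.
have gP p : (forall k, 0 <= rlt_slack k p) -> 0 <= g p.
  case: p => [[t x] D] /rlt_slack_ge0 nn; rewrite /g.
  have [U0 V0 W0 Y0 Z0] := nn.
  have xb i : 0 <= x i 0 <= t.
    have := V0 i 0; have := U0 i 0; rewrite slackUE !mxE subr_ge0.
    by move=> -> ->.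
  (* t >= 0 is implied by 0 <= x_i <= t for any one index i. *)
  have t0 : 0 <= t by case/andP: (xb (Ordinal n0)); exact: le_trans.
  have [tE|tN0] := eqVneq t 0.
    have x0 : x = 0.
      apply/colP => i; rewrite mxE; apply/eqP; rewrite eq_le andbC.
      by have := xb i; rewrite tE.
    have X0 : D + D^T = 0.
      apply/matrixP => i j; rewrite [RHS]mxE; apply/eqP; rewrite eq_le.
      have := Z0 i j; have := Y0 i j.
      by rewrite slackYE x0 !mxE sub0r oppr_ge0 => -> ->.
    have := QD D; rewrite X0 x0 tE !innermx0r; lra.
  have /lP : rltF (t^-1 *: x, t^-1 *: (D + D^T)).
    apply/rltFP; split.
      apply/symmetricmxP; rewrite linearZ /=; congr (_ *: _).
      exact/symmetricmxP/symmetricmx_addtr.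
    by rewrite -(mulVf tN0); apply: rlt_nonneg_scale; rewrite ?invr_ge0.
  rewrite /rlt_obj /= innermx_cV [_%:M _ _]mxE eqxx mulr1n !innermxZr QD.
  have tgt0 : 0 < t by rewrite lt_neqAle eq_sym tN0.
  rewrite subr_ge0 -ler_pdivlMr // => lE; apply: le_trans lE _.
  by rewrite le_eqVlt; apply/orP; left; apply/eqP; field.
have [w w0 wE] := farkas rlt_slack_scalar g_lin gP.
move: (fun t x D => etrans (wE (t, x, D)) (sum_rlt_slack w t x D)).
set u := \col_i _; set v := \col_i _; set W := \matrix_(i, j) _.
set Y := \matrix_(i, j) _; set Z := \matrix_(i, j) _ => LE.
(* The last three goals compare the coefficients of D, of x and of t. *)
exists u, v, W, Y, Z; split.
- by split=> i j; rewrite !mxE.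
- apply: innermx_inj => D; have := LE 0 0 D.
  rewrite rlt_pairingE /= !innermx0r; lra.
- apply: innermx_inj => x; have := LE 0 x 0.
  rewrite rlt_pairingE /= !innermx0r; lra.
- have := LE 1 0 0.
  rewrite rlt_pairingE /= !innermx0r; lra.
Qed.

End Multipliers.

(** * Rounding a minimiser to a vertex *)

Lemma rlt_pairing_ge0 (R : realType) (n : nat) (u v : 'cV[R]_n)
    (W Y Z : 'M[R]_n) t x X :
  0 <=m u -> 0 <=m v -> 0 <=m W -> 0 <=m Y -> 0 <=m Z -> rlt_nonneg t x X ->
  0 <= rlt_pairing u v W Y Z t x X.
Proof.
by move=> u0 v0 W0 Y0 Z0 [? ? ? ? ?]; rewrite !addr_ge0 ?innermx_ge0.
Qed.

Lemma slackW_symmetric (R : realType) (n : nat) t (x : 'cV[R]_n) X :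
  X \is symmetricmx -> slackW t x X \is symmetricmx.
Proof.
move=> /symmetricmxP sX; apply/symmetricmxP/matrixP => i j.
by rewrite mxE !slackWE -[in LHS]sX mxE; ring.
Qed.

Definition round_box (R : realType) (n : nat) (x : 'cV[R]_n) : 'cV[R]_n :=
  \col_i (x i 0 == 1)%:R.

Lemma vertex_round_box (R : realType) (n : nat) (x : 'cV[R]_n) :
  vertex boxF (round_box x).
Proof.
by apply/vertex_boxP => i; rewrite mxE; case: eqP => _; [right | left].
Qed.

(** All five terms of the pairing are nonnegative, so each of them vanishes at
    [x]; rounding down keeps [x_i = 0] and [1 - x_i = 0] where they hold, hence
    keeps every vanishing slack, these being products of such factors. *)
Lemma rlt_pairing_round (R : realType) (n : nat) (u v x : 'cV[R]_n)
    (W Y Z : 'M[R]_n) :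
  0 <=m u -> 0 <=m v -> 0 <=m W -> 0 <=m Y -> 0 <=m Z ->
  boxF x -> rlt_pairing u v W Y Z 1 x (x *m x^T) = 0 ->
  let r := round_box x in let P := r *m r^T in
  [/\ innermx u (slackU 1 r) = 0, innermx v r = 0, innermx W (slackW 1 r P) = 0,
      innermx Y (slackY r P) = 0 & innermx Z P = 0].
Proof.
move=> u0 v0 W0 Y0 Z0 xF /eqP + r P.
have /rltFP[_ [Ux Vx Wx Yx Zx]] := rltF_vertex xF.
rewrite /rlt_pairing !paddr_eq0 ?addr_ge0 ?innermx_ge0 //.
move=> /andP[/andP[/andP[/andP[/eqP Eu /eqP Ev] /eqP EW] /eqP EY] /eqP EZ].
have r1 i : x i 0 = 1 -> r i 0 = 1 by move=> E; rewrite mxE E eqxx.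
have r0 i : x i 0 = 0 -> r i 0 = 0.
  by move=> E; rewrite mxE E eq_sym oner_eq0.
have XE (y : 'cV[R]_n) i j : (y *m y^T) i j = y i 0 * y j 0.
  by rewrite mxE big_ord1 mxE.
split.
- apply: innermx_eq0_supp Eu => // i j; rewrite !slackUE => E.
  by rewrite r1; lra.
- by apply: innermx_eq0_supp Ev => // i j; rewrite ord1; exact: r0.
- apply: innermx_eq0_supp EW => // i j; rewrite !slackWE !XE => E.
  have /eqP : (1 - x i 0) * (1 - x j 0) = 0 by rewrite -E; ring.
  by rewrite mulf_eq0 !subr_eq0 => /orP[] /eqP /esym /r1 ->; ring.
- apply: innermx_eq0_supp EY => // i j; rewrite !slackYE !XE => E.
  have /eqP : x j 0 * (1 - x i 0) = 0 by rewrite -E; ring.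
  rewrite mulf_eq0 subr_eq0 => /orP[] /eqP.
    by move=> /r0 ->; ring.
  by move=> /esym /r1 ->; ring.
- apply: innermx_eq0_supp EZ => // i j; rewrite !XE => /eqP.
  by rewrite mulf_eq0 => /orP[] /eqP /r0 ->; ring.
Qed.

(** * Exactness certified by multipliers at a vertex *)

(** The box problem embeds in the relaxation through [x |-> (x, x x^T)], so a
    relaxed minimiser of this form solves both problems with the same value. *)
Lemma exactR_of_rank1 (R : realType) (n : nat) (Q : 'M[R]_n) (c v : 'cV[R]_n) :
  Q \is symmetricmx -> boxF v ->
  (forall xX, rltF xX -> rlt_obj Q c (v, v *m v^T) <= rlt_obj Q c xX) ->
  exactR (Q, c).
Proof.
move=> sQ vF vmin; split=> //=.
rewrite /lstarR (inf_min (rltF_vertex vF) vmin) -quad_rlt_obj //.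
apply: inf_min => // y yF; rewrite !quad_rlt_obj //.
by apply: vmin; exact: rltF_vertex.
Qed.

Theorem corollary4p4 (R : realType) (n : nat) (hn : (1 <= n)%N)
    (Q : 'M[R]_n) (c : 'cV[R]_n) (hQ : Q \is symmetricmx) :
  exactR (Q, c) <->
  exists (v : 'cV[R]_n) (uh vh : 'cV[R]_n) (Wh Yh Zh : 'M[R]_n),
    let xh := v in
    let Xh := v *m v^T in
    let e : 'cV[R]_n := ones in
    vertex boxF v /\
    Wh \is symmetricmx /\ Zh \is symmetricmx /\
    Q = Wh - Yh - Yh^T + Zh /\
    c = - uh + vh - Wh *m e + Yh^T *m e /\
    uh^T *m (e - xh) = 0 /\
    vh^T *m xh = 0 /\
    innermx Wh (Xh - xh *m e^T - e *m xh^T + e *m e^T) = 0 /\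
    innermx Yh (e *m xh^T - Xh) = 0 /\
    innermx Zh Xh = 0 /\
    0 <=m uh /\ 0 <=m vh /\ 0 <=m Wh /\ 0 <=m Yh /\ 0 <=m Zh.
Proof.
have dotE (a b : 'cV[R]_n) : a^T *m b = 0 <-> innermx a b = 0.
  rewrite innermx_cV; split=> [/matrixP/(_ 0 0)|->]; last exact: raddf0.
  by rewrite !mxE eqxx.
have slackU1 (y : 'cV[R]_n) : slackU 1 y = ones - y by rewrite /slackU scale1r.
have slackW1 (y : 'cV[R]_n) Y' : slackW 1 y Y' =
    Y' - y *m ones^T - ones *m y^T + ones *m ones^T.
  by rewrite /slackW scale1r.
have halfm_ge0 (A : 'M[R]_n) : 0 <=m A -> 0 <=m (2^-1 *: A).
  by move=> A0 i j; have := A0 i j; rewrite !mxE; lra.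
split=> [[_ /= lE] | ].
- have [x [xF xE _]] := lstar_min Q c; have [_ [_ _ Rmin]] := lstarR_min Q c.
  have [u [v [W [Y [Z [[u0 v0 W0 Y0 Z0] QE cE KE]]]]]] := rlt_dual hn hQ Rmin.
  have P0 : rlt_pairing u v W Y Z 1 x (x *m x^T) = 0.
    have := rlt_objE x QE cE (outer_symmetric x).
    by rewrite -quad_rlt_obj // xE lE -KE; lra.
  have [Eu Ev EW EY EZ] := rlt_pairing_round u0 v0 W0 Y0 Z0 xF P0.
  exists (round_box x), u, v, (W + W^T), Y, (Z + Z^T) => /=.
  split; first exact: vertex_round_box.
  split; first exact: symmetricmx_addtr.
  split; first exact: symmetricmx_addtr.
  split=> //; split=> //; split; first by apply/dotE; rewrite -slackU1.
  split; first exact/dotE.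
  split.
    rewrite -slackW1 innermx_addtr ?EW ?mulr0 //.
    exact/slackW_symmetric/outer_symmetric.
  split=> //; split; first by rewrite innermx_addtr ?EZ ?mulr0 ?outer_symmetric.
  by do 2!split=> //; split; [|split=> //]; exact: addtr_ge0.
- case=> r [u [v [W [Y [Z /= [rF [sW [sZ [QE [cE [Eu [Ev [EW [EY [EZ]]]]]]]]]]]]]]].
  move=> [u0 [v0 [W0 [Y0 Z0]]]].
  move: Eu Ev => /dotE Eu /dotE Ev.
  (* The Lagrangian identity symmetrises its multipliers, hence the halves. *)
  have objE y Y' (sY' : Y' \is symmetricmx) :=
    @rlt_objE R n Q (2^-1 *: W) Y (2^-1 *: Z) Y' c u v y.
  rewrite !half_addtr // in objE.
  have [rB _] := rF.
  apply: exactR_of_rank1 rB _ => // -[y Y'] /[dup] yF /rltFP[sY' nnY].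
  rewrite !objE ?outer_symmetric // lerD2r.
  rewrite {1}/rlt_pairing slackU1 slackW1 !innermxZl Eu Ev EW EY EZ !mulr0 !addr0.
  by apply: rlt_pairing_ge0 => //; exact: halfm_ge0.
Qed.
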